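(* Let $(E,\mathcal{P})$ be a g-matroid, $g\colon\mathcal{P}\to\mathbb{R}$ an M$^\natural$-convex function, and $E=E_1\cup\dots\cup E_m$ a partition of $E$ with lexicographic function $\eta\colon\mathcal{P}\to\mathbb{Z}^m$, $\eta(X)_i:=|E_i\cap X|$. Let $\mu\in\mathbb{Z}^m$ be nonnegative and consider the problem $$\min\ g(X)\quad\text{s.t. } X\in\mathcal{P},\ \ \eta(X)\lneq_{\mathrm{lex}}\mu .\qquad(\mathrm{MLB}_\mu)$$ Suppose that $X^*\in\mathcal{P}$ lexicographically minimizes $\eta$ among all the optimal solutions of $(\mathrm{MLB}_\mu)$. Then $X^*$ is Pareto optimal for the biobjective problem of minimizing $(g(X),\eta(X))$ over $X\in\mathcal{P}$ (with respect to $\le$ on $\mathbb{R}$ and $\le_{\mathrm{lex}}$ on $\mathbb{R}^m$).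
   Context: A pair $(E,\mathcal{P})$, with $E$ finite and $\mathcal{P}$ a nonempty family of subsets of $E$, is a g-matroid if for any $P_1,P_2\in\mathcal{P}$ and $v\in P_1\setminus P_2$, either (i) $P_1\setminus\{v\}\in\mathcal{P}$ and $P_2\cup\{v\}\in\mathcal{P}$, or (ii) there is $u\in P_2\setminus P_1$ with $(P_1\setminus\{v\})\cup\{u\}\in\mathcal{P}$ and $(P_2\cup\{v\})\setminus\{u\}\in\mathcal{P}$. A function $g\colon\mathcal{P}\to\mathbb{R}$ is M$^\natural$-convex if, after setting $g(X)=+\infty$ for $X\notin\mathcal{P}$, for all $X,Y\in\mathcal{P}$ and $u\in X\setminus Y$, either $g(X)+g(Y)\ge g(X\setminus\{u\})+g(Y\cup\{u\})$, or there is $v\in Y\setminus X$ with $g(X)+g(Y)\ge g((X\setminus\{u\})\cup\{v\})+g((Y\cup\{u\})\setminus\{v\})$. Lexicographic order on $\mathbb{R}^m$: $x\le_{\mathrm{lex}}y$ iff $x=y$ or there is $k$ with $x_k<y_k$ and $x_i=y_i$ for all $i<k$; $x\lneq_{\mathrm{lex}}y$ means $x\le_{\mathrm{lex}}y$ and $x\ne y$. $X^*$ lexicographically minimizes $\eta$ among a family $\mathcal{X}$ if $X^*\in\mathcal{X}$ and $\eta(X^* )\le_{\mathrm{lex}}\eta(X)$ for all $X\in\mathcal{X}$. $X^*\in\mathcal{P}$ is Pareto optimal if there is no $X\in\mathcal{P}$ with $g(X)\le g(X^* )$, $\eta(X)\le_{\mathrm{lex}}\eta(X^* )$ and $(g(X),\eta(X))\ne(g(X^*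 ),\eta(X^* ))$. *)

(* Defs.v *)
From HB Require Import structures.
From mathcomp Require Import all_boot all_order all_algebra.
From mathcomp Require Import reals constructive_ereal.

Set Implicit Arguments.
Unset Strict Implicit.
Unset Printing Implicit Defensive.

Import Order.TTheory GRing.Theory Num.Theory.

Local Open Scope ring_scope.

(* Throughout, the ground set is the whole finite type [E], and a function
   g : P -> R on a family P is a total function on {set E} whose values outside
   P are never used. *)

Definition gmatroid (E : finType) (P : {set {set E}}) : Prop :=
  P != set0 /\
  forall P1 P2 : {set E}, P1 \in P -> P2 \in P ->
  forall v : E, v \in P1 :\: P2 ->
    (P1 :\ v \in P /\ v |: P2 \in P) \/
    exists2 u : E, u \in P2 :\: P1 &
      u |: (P1 :\ v) \in P /\ (v |: P2) :\ u \in P.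

Definition ext_fun (E : finType) (R : realType) (P : {set {set E}})
    (g : {set E} -> R) (X : {set E}) : \bar R :=
  if X \in P then (g X)%:E else +oo%E.

Definition Mnat_convex (E : finType) (R : realType) (P : {set {set E}})
    (g : {set E} -> R) : Prop :=
  let g' := ext_fun P g in
  forall X Y : {set E}, X \in P -> Y \in P ->
  forall u : E, u \in X :\: Y ->
    (g' (X :\ u) + g' (u |: Y) <= g' X + g' Y)%E \/
    exists2 v : E, v \in Y :\: X &
      (g' (v |: (X :\ u)) + g' ((u |: Y) :\ v) <= g' X + g' Y)%E.

(* The blocks E_1, ..., E_m are ordered (the order matters for eta) and are not
   required to be nonempty. *)
Definition ordered_partition (E : finType) (m : nat) (B : 'I_m -> {set E}) :
    Prop :=
  (forall i j : 'I_m, i != j -> [disjoint B i & B j]) /\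
  \bigcup_(i < m) B i = [set: E].

(* [m.-tuplelexi int] is [m.-tuple int] ordered lexicographically;
   see [lex_leP] and [lex_ltP]. *)
Definition eta (E : finType) (m : nat) (B : 'I_m -> {set E}) (X : {set E}) :
    m.-tuplelexi int :=
  [tuple (#|B i :&: X|%:Z : int) | i < m].

Lemma lex_ltP (m : nat) (x y : m.-tuplelexi int) :
  (x < y)%O <->
  exists k : 'I_m, tnth x k < tnth y k /\
    forall i : 'I_m, (i < k)%N -> tnth x i = tnth y i.
Proof.
split=> [/ltxi_tuplePlt[k e l]|[k [l e]]]; first by exists k.
by apply/ltxi_tuplePlt; exists k => // i /e.
Qed.

Lemma lex_leP (m : nat) (x y : m.-tuplelexi int) :
  (x <= y)%O <->
  x = y \/
  exists k : 'I_m, tnth x k < tnth y k /\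
    forall i : 'I_m, (i < k)%N -> tnth x i = tnth y i.
Proof.
rewrite le_eqVlt; split=> [/orP[/eqP|/lex_ltP]|[->|/lex_ltP ->]].
- by left.
- by right.
- by rewrite eqxx.
- by rewrite orbT.
Qed.

Definition lex_minimizes (E : finType) (m : nat)
    (f : {set E} -> m.-tuplelexi int) (F : {set E} -> Prop) (X : {set E}) :
    Prop :=
  F X /\ forall Y : {set E}, F Y -> (f X <= f Y)%O.

Definition MLB_feasible (E : finType) (P : {set {set E}}) (m : nat)
    (B : 'I_m -> {set E}) (mu : m.-tuplelexi int) (X : {set E}) : Prop :=
  X \in P /\ (eta B X < mu)%O.

Definition MLB_optimal (E : finType) (R : realType) (P : {set {set E}})
    (g : {set E} -> R) (m : nat) (B : 'I_m -> {set E})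
    (mu : m.-tuplelexi int) (X : {set E}) : Prop :=
  MLB_feasible P B mu X /\
  forall Y : {set E}, MLB_feasible P B mu Y -> g X <= g Y.

Definition pareto_optimal (E : finType) (R : realType) (P : {set {set E}})
    (g : {set E} -> R) (m : nat) (f : {set E} -> m.-tuplelexi int)
    (X : {set E}) : Prop :=
  X \in P /\
  ~ exists Y : {set E},
      [/\ Y \in P, g Y <= g X, (f Y <= f X)%O & (g Y, f Y) <> (g X, f X)].

(* Main.v *)
Require Import Defs.
From mathcomp Require Import all_boot all_order all_algebra.
From mathcomp Require Import reals constructive_ereal.

Set Implicit Arguments.
Unset Strict Implicit.
Unset Printing Implicit Defensive.

Import Order.TTheory GRing.Theory Num.Theory.

Local Open Scope ring_scope.

(** The proof rests on the feasible set of (MLB_mu) being a lexicographic down-set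
    within [P]: any [Y] that weakly dominates [Xstar] satisfies
    [eta Y <= eta Xstar < mu], so it competes in the constrained problem. There
    [Xstar] has least cost, so [g Y = g Xstar] and [Y] is optimal as well;
    lexicographic minimality of [Xstar] among the optima then gives
    [eta Y = eta Xstar], so no domination is strict. *)
Theorem theorem5p1 (R : realType) (E : finType) (P : {set {set E}})
    (g : {set E} -> R) (m : nat) (B : 'I_m -> {set E})
    (mu : m.-tuplelexi int) (Xstar : {set E})
    (hP : gmatroid P) (hg : Mnat_convex P g) (hB : ordered_partition B)
    (hmu : forall i : 'I_m, 0 <= tnth mu i)
    (hX : Xstar \in P)
    (hmin : lex_minimizes (eta B) (MLB_optimal P g B mu) Xstar) :
  pareto_optimal P g (eta B) Xstar.
Proof.
case: hmin => -[[_ etaX_lt_mu] gX_min] etaX_min.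
split=> // -[Y [YP gY_le etaY_le]]; apply.
have Y_feas : MLB_feasible P B mu Y by split=> //; apply: le_lt_trans etaX_lt_mu.
have gYX : g Y = g Xstar by apply/le_anti; rewrite gY_le gX_min.
have Y_opt : MLB_optimal P g B mu Y.
  by split=> // Z Z_feas; rewrite gYX gX_min.
by congr (_, _) => //; apply/le_anti; rewrite etaY_le etaX_min.
Qed.
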